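(* There exist a constant $c\in[0,1)$ and an integer $k_0$ such that the following holds. Let $f:\mathbb{F}_2^n\to\{-1,1\}$ be any Boolean function whose Fourier sparsity $k$ satisfies $k\ge k_0$. Let $p=\frac{1}{2k^{1/2}}$ and let $\mathcal{R}$ be the random set returned by $\textsc{SampleParity}(f,p)$. Then \[ \mathbb{E}\big[\mathcal{B}(f,\mathsf{span}\,\mathcal{R})\big]\le ck . \]
   Context: For $\alpha\in\mathbb{F}_2^n$ let $\chi_\alpha(x)=(-1)^{\sum_i\alpha_ix_i}$. Every $f:\mathbb{F}_2^n\to\mathbb{R}$ has a unique expansion $f=\sum_{\alpha}\widehat f(\alpha)\chi_\alpha$ with $\widehat f(\alpha)=2^{-n}\sum_x f(x)\chi_\alpha(x)$. The Fourier support of $f$ is $\mathcal{S}=\{\alpha:\widehat f(\alpha)\neq0\}$ and its Fourier sparsity is $k=|\mathcal{S}|$. $\textsc{SampleParity}(f,p)$ returns a random subset $\mathcal{R}\subseteq\mathcal{S}$ obtained by including each $\alpha\in\mathcal{S}$ independently with probability $p$. For a set $\Gamma\subseteq\mathbb{F}_2^n$, $\mathsf{span}\,\Gamma$ is the set of all $\mathbb{F}_2$-linear combinations of elements of $\Gamma$. For a linear subspace $\mathcal{G}\subseteq\mathbb{F}_2^n$, the bucket complexity $\mathcal{B}(f,\mathcal{G})$ is the number of cosets $\mathcal{G}+\beta$ ($\beta\in\mathbb{F}_2^n$) that have non-empty intersection with $\mathcal{S}$. *)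

(* Defs.v *)
From HB Require Import structures.
From mathcomp Require Import all_boot all_order all_algebra.
From mathcomp Require Import reals.

Set Implicit Arguments.
Unset Strict Implicit.
Unset Printing Implicit Defensive.

Import Order.TTheory GRing.Theory Num.Theory.

Local Open Scope ring_scope.

(* The inner product is computed in 'F_2; its representative in {0, 1} is the
   exponent. *)
Definition chi (R : realType) (n : nat) (alpha x : 'rV['F_2]_n) : R :=
  (-1) ^+ nat_of_ord (\sum_(i < n) alpha 0 i * x 0 i).

Definition fourier (R : realType) (n : nat) (f : 'rV['F_2]_n -> R)
    (alpha : 'rV['F_2]_n) : R :=
  (2 ^+ n)^-1 * \sum_(x : 'rV['F_2]_n) f x * chi R alpha x.

Definition fourier_support (R : realType) (n : nat) (f : 'rV['F_2]_n -> R) :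
    {set 'rV['F_2]_n} :=
  [set alpha | fourier f alpha != 0].

Definition sparsity (R : realType) (n : nat) (f : 'rV['F_2]_n -> R) : nat :=
  #|fourier_support f|.

Definition boolean_valued (R : realType) (n : nat) (f : 'rV['F_2]_n -> R) :
    Prop :=
  forall x, f x = -1 \/ f x = 1.

Definition coset_of_vspace (n : nat) (G : {vspace 'rV['F_2]_n})
    (beta : 'rV['F_2]_n) : {set 'rV['F_2]_n} :=
  [set g + beta | g in G].

(* Cosets are counted as sets, so different representatives of the same coset
   contribute once. *)
Definition bucket_complexity (R : realType) (n : nat) (f : 'rV['F_2]_n -> R)
    (G : {vspace 'rV['F_2]_n}) : nat :=
  #|[set C in [set coset_of_vspace G beta | beta : 'rV['F_2]_n] |
      C :&: fourier_support f != set0]|.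

Definition span_set (n : nat) (Gamma : {set 'rV['F_2]_n}) :
    {vspace 'rV['F_2]_n} :=
  <<enum Gamma>>%VS.

(* Probability mass function of the random subset of the Fourier support in
   which every element is included independently with probability p. *)
Definition sample_parity (R : realType) (n : nat) (f : 'rV['F_2]_n -> R)
    (p : R) (A : {set 'rV['F_2]_n}) : R :=
  if A \subset fourier_support f
  then \prod_(alpha in fourier_support f) (if alpha \in A then p else 1 - p)
  else 0.

Definition expectation (R : realType) (T : finType) (mu : T -> R)
    (X : T -> R) : R :=
  \sum_(t : T) mu t * X t.

(* Main.v *)
(* Since f ^ 2 = 1, the sum of fhat(g) fhat(g + a + u) over g vanishes, so for
   distinct a, u in the support S there are v, w in S outside {a, u} with
   u + v + w = a.  Fix a.  If R contains u together with v (or w), then a falls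
   into the bucket of w (or v).  Selecting for many u a partner x(u) among v, w
   so that no partner is used more than about 4 sqrt k times, a second moment
   argument shows that R contains some pair {u, x(u)} with probability bounded
   below by a constant.  So on average a constant fraction of S shares its bucket
   with another element of S, and each such element saves half a bucket. *)
Require Import Defs.
From HB Require Import structures.
From mathcomp Require Import all_boot all_order all_algebra.
From mathcomp Require Import reals lra ring zify.

Set Implicit Arguments.
Unset Strict Implicit.
Unset Printing Implicit Defensive.

Import Order.TTheory GRing.Theory Num.Theory.

Local Open Scope ring_scope.

(** * Characters of F_2^n and the folding property of the Fourier support *)

Section Characters.
Variables (R : realType) (n : nat).
Implicit Types (alpha beta x y : 'rV['F_2]_n) (f : 'rV['F_2]_n -> R).

Lemma signF2D (a b : 'F_2) :
  (-1) ^+ nat_of_ord (a + b) = (-1) ^+ nat_of_ord a * (-1) ^+ nat_of_ord b :> R.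
Proof.
by case: a => [[|[|//]]] ?; case: b => [[|[|//]]] ?;
   rewrite ?expr0 ?expr1 ?mulr1 ?mul1r ?mulrNN ?mulr1.
Qed.

Lemma addrrF2 x : x + x = 0.
Proof.
apply/rowP => i; rewrite !mxE; apply/val_inj.
by case: (x 0 i) => [[|[|//]]].
Qed.

Lemma opprF2 x : - x = x.
Proof. by apply: (addrI x); rewrite subrr addrrF2. Qed.

Lemma chiC alpha x : chi R alpha x = chi R x alpha.
Proof. by rewrite /chi; under eq_bigr do rewrite mulrC. Qed.

Lemma chiDr alpha x y : chi R alpha (x + y) = chi R alpha x * chi R alpha y.
Proof.
rewrite /chi -signF2D -big_split; congr ((-1) ^+ nat_of_ord _).
by apply: eq_bigr => i _; rewrite mxE mulrDr.
Qed.

Lemma chiDl alpha beta x : chi R (alpha + beta) x = chi R alpha x * chi R beta x.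
Proof. by rewrite chiC chiDr !(chiC x). Qed.

Lemma sum_chi alpha : alpha != 0 -> \sum_x chi R alpha x = 0.
Proof.
move=> alpha_neq0; have [i ai] : exists i, alpha 0 i != 0.
  apply/existsP; apply: contraR alpha_neq0; rewrite negb_exists => /forallP a0.
  by apply/eqP/rowP => i; rewrite mxE; apply/eqP/negPn/a0.
have chi_i : chi R alpha (delta_mx 0 i) = -1.
  rewrite /chi (bigD1 i) // big1 ?addr0 => [|j /negPf ji].
    rewrite mxE !eqxx mulr1; move: ai.
    by case: (alpha 0 i) => [[|[|//]]] ? //; rewrite expr1.
  by rewrite mxE ji andbF mulr0.
have: \sum_x chi R alpha x = - \sum_x chi R alpha x.
  rewrite {1}(reindex_inj (addIr (delta_mx 0 i))) /= -sumrN.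
  by apply: eq_bigr => x _; rewrite chiDr chi_i mulrN1.
by move=> /esym/eqP; rewrite eqNr => /eqP.
Qed.

(** Expanding both coefficients and summing over [beta] first, orthogonality of characters leaves
    only the diagonal [y = x]. *)
Lemma sum_fourierM f alpha :
  \sum_beta fourier f beta * fourier f (beta + alpha) =
  (2 ^+ n)^-1 * \sum_x f x ^+ 2 * chi R alpha x.
Proof.
have sumC y x : \sum_beta chi R beta y * chi R beta x = (2 ^+ n) *+ (y == x).
  under eq_bigr do rewrite -chiDr chiC.
  have [->|yx] := eqVneq y x.
    rewrite addrrF2; under eq_bigr => b _.
      rewrite /chi big1 => [|i _]; last by rewrite mxE mul0r.
      over.
    by rewrite sumr_const card_mx card_Fp // mul1n natrX.
  rewrite sum_chi //; apply: contra_neq yx => yx0.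
  by rewrite -[y]addr0 -(addrrF2 x) addrA yx0 add0r.
transitivity ((2 ^+ n)^-1 * ((2 ^+ n)^-1 *
  \sum_y \sum_x f y * f x * chi R alpha x * (2 ^+ n *+ (y == x)))); last first.
  congr (_ * _); rewrite mulr_sumr; apply: eq_bigr => x _.
  rewrite (bigD1 x) //= big1 => [|y /negPf yx]; last first.
    by rewrite eq_sym yx mulr0n mulr0.
  rewrite eqxx addr0 mulr1n mulrCA mulVf ?mulr1 //.
  by rewrite expf_neq0 // pnatr_eq0.
rewrite /fourier; under eq_bigr do rewrite mulrACA -mulrA big_distrlr /=.
rewrite -!mulr_sumr exchange_big /=; do 2 congr (_ * _).
apply: eq_bigr => y _; rewrite exchange_big /=; apply: eq_bigr => x _.
by rewrite -sumC mulr_sumr; apply: eq_bigr => b _; rewrite chiDl; ring.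
Qed.

(** As [f ^ 2 = 1], the autocorrelation of the spectrum at [alpha + beta] is the mean of a
    nontrivial character, hence 0. The terms at [alpha] and [beta] are equal and nonzero, so they
    add up rather than cancel, and a third nonzero term must exist. *)
Lemma fourier_support_folding f alpha beta :
  boolean_valued f -> alpha \in fourier_support f -> beta \in fourier_support f ->
  alpha != beta ->
  exists gamma, [/\ gamma != alpha, gamma != beta, gamma \in fourier_support f
                  & gamma + (alpha + beta) \in fourier_support f].
Proof.
move=> fB; rewrite !inE => aS bS ab.
have ab0 : alpha + beta != 0.
  apply: contra_neq ab => ab0.
  by rewrite -[alpha]addr0 -(addrrF2 beta) addrA ab0 add0r.
have := sum_fourierM f (alpha + beta).
under [X in _ = _ * X]eq_bigr => x _.
  have -> : f x ^+ 2 = 1 by case: (fB x) => ->; rewrite ?sqrrN expr1n.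
  rewrite mul1r; over.
rewrite sum_chi // mulr0 (bigD1 alpha) //= (bigD1 beta) 1?eq_sym //=.
have -> : beta + (alpha + beta) = alpha by rewrite addrCA addrrF2 addr0.
have -> : alpha + (alpha + beta) = beta by rewrite addrA addrrF2 add0r.
rewrite addrA [fourier f beta * _]mulrC -mulr2n => sum0.
case: (pickP [pred g | [&& g != alpha, g != beta, fourier f g != 0
                         & fourier f (g + (alpha + beta)) != 0]]) => [g|none].
  by case/and4P => *; exists g; rewrite !inE.
move: sum0; rewrite big1 ?addr0 => [/eqP|g /andP[gb ga]].
  by rewrite mulrn_eq0 mulf_eq0 (negPf aS) (negPf bS).
apply/eqP; rewrite mulf_eq0 -[_ || _]negbK negb_or.
by have := none g; rewrite /= gb ga /= => ->.
Qed.

End Characters.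

Lemma sum_indicator (R : pzSemiRingType) (T : finType) (U : {set T}) (P : pred T) :
  \sum_(u in U) (P u)%:R = #|[set u in U | P u]|%:R :> R.
Proof.
rewrite -sum1dep_card natr_sum big_mkcondr; apply: eq_bigr => u _.
by case: (P u).
Qed.

(** * Moments of pair counts in a random subset *)

Section RandomSubset.
Variables (R : realFieldType) (T : finType) (S : {set T}) (p : R).
Implicit Types (A U : {set T}).

(** Same body as [sample_parity] over an abstract finite set, so what is proved here transfers by
    conversion. *)
Definition subset_pmf A : R :=
  if A \subset S then \prod_(a in S) (if a \in A then p else 1 - p) else 0.

(** Puts the mass in the shape [bigA_distr] expects, a product over all of [T]: a factor 0 excludes
    sets leaving [S], and a factor 0 for absence on [U] encodes [U \subset A]. *)
Lemma subset_pmfE A (q : R) (U : {set T}) : U \subset S ->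
  (if A \subset S then
     \prod_(a in S) (if a \in A then p else if a \in U then 0 else q) else 0) =
  \prod_a (if a \in A then (if a \in S then p else 0)
           else (if a \in S then (if a \in U then 0 else q) else 1)).
Proof.
move=> US; case: ifPn => [AS|/subsetPn[a aA /negPf aS]]; last first.
  by rewrite (bigD1 a) //= aA aS mul0r.
rewrite big_mkcond; apply: eq_bigr => a _.
by case: ifPn => // aS; rewrite (negPf (contra (subsetP AS a) aS)).
Qed.

Lemma sum_subset_pmf_superset U : U \subset S ->
  \sum_A subset_pmf A * (U \subset A)%:R = p ^+ #|U|.
Proof.
move=> US.
transitivity (\sum_(A : {set T}) \prod_a
    (if a \in A then (if a \in S then p else 0)
     else (if a \in S then (if a \in U then 0 else 1 - p) else 1))).
  apply: eq_bigr => A _; rewrite -(subset_pmfE A (1 - p) US) /subset_pmf.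
  case: ifP => _; last by rewrite mul0r.
  have [UA|/subsetPn[a aU /negPf aA]] := boolP (U \subset A); last first.
    by rewrite mulr0 [RHS](bigD1 a) ?(subsetP US) //= aA aU mul0r.
  rewrite mulr1; apply: eq_bigr => a _; case: ifPn => // aA.
  by rewrite (negPf (contra (subsetP UA a) aA)).
(* The sum factors over elements: [p + 0] on [U], [p + (1 - p)] on the rest of [S], [0 + 1] outside
   [S]. *)
have := bigA_distr 1 +%R (fun a => if a \in S then p else 0)
  (fun a => if a \in S then (if a \in U then 0 else 1 - p) else 1).
move=> <-; rewrite -prodr_const [RHS]big_mkcond; apply: eq_bigr => a _.
case: ifPn => [_|aS]; first by case: ifP => _ /=; rewrite ?addr0 // addrC subrK.
by rewrite /= add0r (negPf (contra (subsetP US a) aS)).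
Qed.

Lemma sum_subset_pmf : \sum_A subset_pmf A = 1.
Proof.
have := sum_subset_pmf_superset (sub0set S).
rewrite cards0 expr0 => <-; apply: eq_bigr => A _.
by rewrite sub0set mulr1.
Qed.

Lemma subset_pmf_ge0 A : 0 <= p <= 1 -> 0 <= subset_pmf A.
Proof.
case/andP=> p0 p1; rewrite /subset_pmf; case: ifP => // _.
by apply: prodr_ge0 => a _; case: ifP; rewrite // subr_ge0.
Qed.

(* The bound compares an indicator with a quadratic: if X is nonnegative then
   [X > 0] >= 2 l X - l^2 X^2 for every l; here l = 1/16. *)
Lemma edge_hitting_prob (U : {set T}) (x : T -> T) :
  0 <= p <= 1 -> 4 * #|S|%:R * p ^+ 2 = 1 ->
  U \subset S -> (#|S| <= 2 * #|U|)%N ->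
  (forall u, u \in U -> x u \in S /\ x u != u) ->
  (forall y, p * #|[set u in U | x u == y]|%:R <= 2) ->
  1 / 128%:R <=
  \sum_A subset_pmf A * [exists u in U, [set u; x u] \subset A]%:R.
Proof.
move=> p01 kp US kU xU deg.
have [p0 p1] := andP p01.
pose e u := [set u; x u].
have eS u : u \in U -> e u \subset S.
  by move=> uU; rewrite subUset !sub1set (subsetP US) // (xU u uU).1.
pose X A : R := \sum_(u in U) (e u \subset A)%:R.
have EX : \sum_A subset_pmf A * X A = #|U|%:R * p ^+ 2.
  under eq_bigr do rewrite mulr_sumr.
  rewrite exchange_big /= mulr_natl -sumr_const; apply: eq_bigr => u uU.
  by rewrite sum_subset_pmf_superset ?eS // cards2 eq_sym (xU u uU).2.
(* The union of two pairs has 4 points if they are disjoint, at least 3 if [u'] is outside [e u],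
   and at least 2 always; each possible coincidence is charged the matching power of [p]. *)
have pair u u' : u \in U -> u' \in U ->
    p ^+ #|e u :|: e u'| <=
    p ^+ 4 + p ^+ 3 * ((x u' == u)%:R + (x u' == x u)%:R) +
    p ^+ 2 * ((u' == u)%:R + (u' == x u)%:R).
  move=> uU u'U.
  have [_ xu] := xU u uU; have [_ xu'] := xU u' u'U.
  have pX i j : (i <= j)%N -> p ^+ j <= p ^+ i by move=> ij; apply: ler_wiXn2l.
  have p_ge0 i : 0 <= p ^+ i by apply: exprn_ge0.
  have c2 : (2 <= #|e u :|: e u'|)%N.
    apply: leq_trans (subset_leq_card (subsetUl _ _)).
    by rewrite cards2 eq_sym xu.
  have := p_ge0 2%N; have := p_ge0 3%N; have := p_ge0 4%N => P4 P3 P2.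
  have [h|uu'] := eqVneq u' u.
    by have := pX _ _ c2; do 2 case: (x u' == _) => /=; case: (_ == _) => /=; lra.
  have [h|xuu'] := eqVneq u' (x u).
    by have := pX _ _ c2; do 2 case: (x u' == _) => /=; lra.
  have c3 : (3 <= #|e u :|: e u'|)%N.
    rewrite (cardsD1 u') !inE eqxx orbT add1n ltnS.
    apply: leq_trans (subset_leq_card (_ : e u \subset _)).
      by rewrite cards2 eq_sym xu.
    by rewrite subUset !sub1set !inE (eq_sym u) uu' (eq_sym (x u)) xuu' !eqxx !orbT.
  have [h|xu'u] := eqVneq (x u') u.
    by have := pX _ _ c3; case: (_ == _) => /=; lra.
  have [h|xu'xu] := eqVneq (x u') (x u).
    by have := pX _ _ c3 => /=; lra.
  have c4 : (4 <= #|e u :|: e u'|)%N.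
    rewrite cardsU disjoint_setI0 ?cards0 ?subn0 ?cards2.
      by rewrite eq_sym xu eq_sym xu'.
    rewrite -setI_eq0; apply/eqP/setP => y; rewrite !inE.
    apply/negP => /andP[/orP[]/eqP-> /orP[]].
    - by rewrite eq_sym (negPf uu').
    - by rewrite eq_sym (negPf xu'u).
    - by rewrite eq_sym (negPf xuu').
    - by rewrite eq_sym (negPf xu'xu).
  by have := pX _ _ c4 => /=; lra.
have kR : 0 <= #|S|%:R :> R by [].
have UR : #|U|%:R <= #|S|%:R :> R by rewrite ler_nat subset_leq_card.
have SU : #|S|%:R <= 2 * #|U|%:R :> R by rewrite -natrM ler_nat.
(* With [k = #|S|], the bound reached is [(k p^2)^2 + 6 k p^2 = 1/16 + 3/2]. The 6 is 2 + 2 from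
   [deg] at [u] and [x u], plus 1 + 1 from [u' = u] and [u' = x u]. *)
have EX2 : \sum_A subset_pmf A * X A ^+ 2 <= 2.
  have -> : \sum_A subset_pmf A * X A ^+ 2 =
      \sum_(u in U) \sum_(u' in U) p ^+ #|e u :|: e u'|.
    under eq_bigr do rewrite expr2 /X big_distrlr /= mulr_sumr.
    rewrite exchange_big; apply: eq_bigr => u uU.
    under eq_bigr do rewrite mulr_sumr.
    rewrite exchange_big; apply: eq_bigr => u' u'U.
    have eeS : e u :|: e u' \subset S by apply/subUsetP; split; apply: eS.
    rewrite -(sum_subset_pmf_superset eeS).
    by apply: eq_bigr => A _; rewrite (subUset _ (e u)) -natrM mulnb.
  have sum1 y : \sum_(u' in U) (u' == y)%:R <= 1 :> R.
    rewrite sum_indicator lern1 -(cards1 y).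
    by apply/subset_leq_card/subsetP => z; rewrite !inE => /andP[].
  have sumx y : p * \sum_(u' in U) (x u' == y)%:R <= 2 :> R.
    by rewrite sum_indicator; apply: deg.
  have sum_pair u : u \in U ->
      \sum_(u' in U) p ^+ #|e u :|: e u'| <= #|S|%:R * p ^+ 4 + 6 * p ^+ 2.
    move=> uU; apply: le_trans (ler_sum _ (fun u' => pair u u' uU)) _.
    rewrite !big_split /= -!mulr_sumr !big_split /= sumr_const.
    rewrite -[_ *+ #|_|]mulr_natl.
    have := sumx u; have := sumx (x u); have := sum1 u; have := sum1 (x u).
    set a := \sum_(_ in _) _; set b := \sum_(_ in _) _.
    set c := \sum_(_ in _) _; set d := \sum_(_ in _) _ => Ha Hb Hc Hd.
    have P2 : 0 <= p ^+ 2 by apply: exprn_ge0.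
    have P4 : 0 <= p ^+ 4 by apply: exprn_ge0.
    have h1 : #|U|%:R * p ^+ 4 <= #|S|%:R * p ^+ 4 by apply: ler_wpM2r.
    have h2 : p ^+ 2 * (p * c) <= p ^+ 2 * 2 by apply: ler_wpM2l.
    have h3 : p ^+ 2 * (p * d) <= p ^+ 2 * 2 by apply: ler_wpM2l.
    have h4 : p ^+ 2 * a <= p ^+ 2 * 1 by apply: ler_wpM2l.
    have h5 : p ^+ 2 * b <= p ^+ 2 * 1 by apply: ler_wpM2l.
    have -> : p ^+ 3 = p ^+ 2 * p by rewrite exprSr.
    lra.
  apply: le_trans (ler_sum _ sum_pair) _; rewrite sumr_const -[_ *+ #|_|]mulr_natl.
  apply: le_trans (_ : #|S|%:R * (#|S|%:R * p ^+ 4 + 6 * p ^+ 2) <= _).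
    by apply: ler_wpM2r => //; rewrite addr_ge0 ?mulr_ge0 ?exprn_ge0.
  have -> : #|S|%:R * (#|S|%:R * p ^+ 4 + 6 * p ^+ 2) =
    (#|S|%:R * p ^+ 2) ^+ 2 + 6 * (#|S|%:R * p ^+ 2) by ring.
  have -> : #|S|%:R * p ^+ 2 = 1 / 4 by lra.
  lra.
(* The mean of [X] is at least [k p^2 / 2 = 1/8], so the quadratic has mean at least
   [1/64 - 2/256 = 1/128]. *)
apply: le_trans (_ : \sum_A subset_pmf A * (X A / 8 - X A ^+ 2 / 256%:R) <= _).
  rewrite (_ : \sum_A _ = (\sum_A subset_pmf A * X A) / 8 -
     (\sum_A subset_pmf A * X A ^+ 2) / 256%:R); last first.
    rewrite !mulr_suml -sumrB; apply: eq_bigr => A _; ring.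
  have P2 : 0 <= p ^+ 2 by apply: exprn_ge0.
  have : #|S|%:R * p ^+ 2 <= 2 * #|U|%:R * p ^+ 2 by apply: ler_wpM2r.
  rewrite EX; lra.
apply: ler_sum => A _; apply: (ler_wpM2l (subset_pmf_ge0 A p01)).
have [_|none] := boolP [exists u in U, [set u; x u] \subset A] => /=.
  by have := sqr_ge0 (1 - X A / 16%:R); lra.
rewrite /X big1 => [|u uU]; first by lra.
by move: none; rewrite negb_exists_in => /forall_inP/(_ u uU)/negPf->.
Qed.

End RandomSubset.

(** * Choosing partners so that none is used too often *)

Section LowIndegree.
Variables (R : realFieldType) (T : finType).

(* Fewer than p |D| vertices lie in more than 2 / p of the pairs, hence at most
   |D| / 4 of the pairs have both ends among those. *)
Lemma low_indegree_choice (p : R) (k : nat) (D : {set T}) (v w : T -> T) :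
  0 < p -> 4 * k%:R * p ^+ 2 = 1 -> (4 <= k)%N -> #|D|.+1 = k ->
  {in D &, injective (fun u => (v u, w u))} ->
  exists (U : {set T}) (x : T -> T),
    [/\ U \subset D, (k <= 2 * #|U|)%N,
        forall u, x u = v u \/ x u = w u
      & forall y, p * #|[set u in U | x u == y]|%:R <= 2].
Proof.
move=> p0 kp k4 Dk vw_inj.
pose deg y := #|[set u in D | (v u == y) || (w u == y)]|.
pose B := [set y | 2 < p * (deg y)%:R].
pose bad := [set u in D | (v u \in B) && (w u \in B)].
have sum_deg : (\sum_y deg y <= 2 * #|D|)%N.
  have sum_pred1 (y : T) : \sum_z ((y == z) : nat) = 1%N.
    by rewrite (bigD1 y) //= eqxx big1 // => z /negPf; rewrite eq_sym => ->.
  rewrite mulnC -sum_nat_const.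
  under eq_bigr do rewrite /deg -sum1dep_card big_mkcondr /=.
  rewrite exchange_big; apply: leq_sum => u _ /=.
  apply: leq_trans (_ : _ <= \sum_y ((v u == y) + (w u == y)))%N _; last first.
    by rewrite big_split /= !sum_pred1.
  by apply: leq_sum => y _; do 2 case: (_ == y).
have cardB : #|B|%:R <= p * #|D|%:R.
  have : \sum_(y in B) 2 <= p * \sum_y (deg y)%:R.
    rewrite mulr_sumr [leRHS](bigID (mem B)) /=.
    apply: le_trans (_ : \sum_(y in B) p * (deg y)%:R <= _).
      by apply: ler_sum => y; rewrite inE => /ltW.
    by rewrite lerDl sumr_ge0 // => y _; rewrite mulr_ge0 // ltW.
  rewrite sumr_const -natr_sum -[2 *+ _]mulr_natr.
  have : p * (\sum_y deg y)%:R <= p * (2 * #|D|%:R).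
    by rewrite ler_wpM2l ?(ltW p0) // -natrM ler_nat.
  lra.
(* By [vw_inj], [bad] embeds into [B * B]. *)
have card_bad : (#|bad| <= #|B| ^ 2)%N.
  rewrite -(card_in_imset (f := fun u => (v u, w u)) (D := mem bad)); last first.
    by move=> u u' /setIdP[uD _] /setIdP[u'D _]; apply: vw_inj.
  rewrite -mulnn -cardsX; apply/subset_leq_card/subsetP => _ /imsetP[u ubad ->].
  by move: ubad; rewrite !inE => /andP[].
have cardU : (#|D| <= #|bad| + #|D :\: bad|)%N.
  by rewrite -(cardsID bad D) leq_add2r subset_leq_card ?subsetIr.
(* Off [bad] one of [v u], [w u] avoids [B], and this choice takes such a one. *)
exists (D :\: bad), (fun u => if v u \in B then w u else v u); split.
- exact: subsetDl.
(* [#|bad| <= (p k)^2 = k / 4] leaves at least [3 k / 4 - 1] elements, which is at least [k / 2]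
   because [k >= 4]. *)
- rewrite -(ler_nat R) natrM.
  have bad_le : #|bad|%:R <= (p * #|D|%:R) ^+ 2.
    apply: le_trans (_ : #|B|%:R ^+ 2 <= _); first by rewrite -natrX ler_nat.
    by rewrite ler_pXn2r ?nnegrE // mulr_ge0 // ltW.
  have Dk' : #|D|%:R = k%:R - 1 :> R by rewrite -Dk -natr1 addrK.
  have k4' : 4 <= k%:R :> R by rewrite ler_nat.
  have cardU' : #|D|%:R <= #|bad|%:R + #|D :\: bad|%:R :> R.
    by rewrite -natrD ler_nat.
  have : (p * #|D|%:R) ^+ 2 <= (p * k%:R) ^+ 2.
    rewrite ler_pXn2r ?nnegrE ?mulr_ge0 // ?(ltW p0) //.
    by rewrite ler_wpM2l ?(ltW p0) // ler_nat -Dk.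
  have -> : (p * k%:R) ^+ 2 = k%:R / 4.
    by rewrite exprMn expr2 [k%:R ^+ 2]expr2; nra.
  lra.
- by move=> u; case: ifP; [right | left].
- move=> y; have [yB|yB] := boolP (y \in B).
    rewrite (_ : [set u in _ | _] = set0) ?cards0 ?mulr0 //.
    apply/setP => u; rewrite in_set0 in_set in_setD [u \in bad]in_set.
    apply/negP => /andP[/andP[nB uD] /eqP]; move: nB; rewrite uD /= negb_and.
    move=> /orP nB; case: ifPn => [vB|/negP nvB] xuy; last by rewrite xuy in nvB.
    by case: nB; rewrite ?vB // xuy yB.
  apply: le_trans (_ : p * (deg y)%:R <= 2); last by rewrite inE -leNgt in yB.
  rewrite ler_wpM2l ?(ltW p0) // ler_nat; apply/subset_leq_card/subsetP => u.
  rewrite in_set in_setD in_set => /andP[/andP[_ ->]] /=.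
  by case: ifP => _ ->; rewrite ?orbT.
Qed.

End LowIndegree.

(** Counted fibre by fibre: a singleton fibre contributes 2 + 0 on the left and 2 on the right; a
    fibre of size m >= 2 contributes 2 + m <= 2 m. *)
Lemma card_imset_collisions (T T' : finType) (phi : T -> T') (S : {set T}) :
  (2 * #|phi @: S| +
     #|[set a in S | [exists b in S, (b != a) && (phi b == phi a)]]|
   <= 2 * #|S|)%N.
Proof.
set M := [set _ in S | _].
have -> : #|M| = (\sum_(a in S) (a \in M))%N.
  rewrite -sum1dep_card big_mkcondr; apply: eq_bigr => a aS.
  by rewrite inE aS; case: exists_inP.
rewrite mulnC -sum_nat_const [(2 * _)%N]mulnC -sum_nat_const.
rewrite [X in (_ + X <= _)%N](partition_big_imset phi).
rewrite [X in (_ <= X)%N](partition_big_imset phi) -big_split /=.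
apply: leq_sum => _ /imsetP[a aS ->].
have [aM|aM] := boolP (a \in M).
  have /setIdP[_ /exists_inP[b bS /andP[ba fba]]] := aM.
  rewrite (bigD1 a) ?aS //= (bigD1 b) ?bS ?fba //=.
  rewrite [leqRHS](bigD1 a) ?aS //= [X in (_ <= 2 + X)%N](bigD1 b) ?bS ?fba //=.
  have : (\sum_(i in S | [&& phi i == phi a, i != a & i != b]) (i \in M) <=
          \sum_(i in S | [&& phi i == phi a, i != a & i != b]) 2)%N.
    by apply: leq_sum => i _; case: (i \in M).
  under [X in (_ + (_ + (_ + X)) <= _)%N]eq_bigl do rewrite -!andbA.
  under [X in (_ <= _ + (_ + X))%N]eq_bigl do rewrite -!andbA.
  by have := leq_b1 (a \in M); have := leq_b1 (b \in M); lia.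
rewrite (bigD1 a) ?aS //= [leqRHS](bigD1 a) ?aS //= (negPf aM) add0n leq_add2l.
by apply: leq_sum => i _; case: (i \in M).
Qed.

(** * Buckets and collisions of support elements *)

Section Buckets.
Variables (R : realType) (n : nat).
Implicit Types (G : {vspace 'rV['F_2]_n}) (f : 'rV['F_2]_n -> R).

Lemma coset_of_vspace_eq G a b :
  b - a \in G -> coset_of_vspace G b = coset_of_vspace G a.
Proof.
move=> baG; apply/setP => z; apply/imsetP/imsetP => -[g gG ->].
  by exists (g + (b - a)); [apply: memvD | rewrite -addrA subrK].
exists (g - (b - a)); first exact: memvB.
by rewrite opprB -addrA addrNK.
Qed.

Lemma bucket_complexity_le f G :
  (bucket_complexity f G <= #|coset_of_vspace G @: fourier_support f|)%N.
Proof.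
apply/subset_leq_card/subsetP => C.
rewrite inE => /andP[/imsetP[b _ ->] /set0Pn[c]].
rewrite inE => /andP[/imsetP[g gG ->] gbS].
by rewrite -(@coset_of_vspace_eq _ _ (g + b)) ?imset_f // addrK.
Qed.

(** Applies [card_imset_collisions] to the map sending an element to its coset; the factor 1/2 is
    sharp when shared buckets hold two elements. *)
Lemma bucket_complexity_collisions f G :
  (bucket_complexity f G)%:R <= #|fourier_support f|%:R -
    (\sum_(a in fourier_support f)
       [exists b in fourier_support f, (b != a) && (b - a \in G)]%:R) / 2 :> R.
Proof.
set S := fourier_support f.
have h := card_imset_collisions (coset_of_vspace G) S.
have : (\sum_(a in S) [exists b in S, (b != a) && (b - a \in G)]%:R : R) <=
    #|[set a in S | [exists b in S, (b != a) &&
        (coset_of_vspace G b == coset_of_vspace G a)]]|%:R.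
  rewrite sum_indicator ler_nat; apply/subset_leq_card/subsetP => a.
  rewrite !inE => /andP[-> /exists_inP[b bS /andP[ba baG]]] /=.
  by apply/exists_inP; exists b; rewrite // ba (coset_of_vspace_eq baG) eqxx.
have := bucket_complexity_le f G; rewrite -/S -(ler_nat R).
by move: h; rewrite -(ler_nat R) natrD !natrM; lra.
Qed.

Lemma collision_prob f (p : R) a :
  boolean_valued f -> (4 <= #|fourier_support f|)%N ->
  0 < p <= 1 -> 4 * #|fourier_support f|%:R * p ^+ 2 = 1 ->
  a \in fourier_support f ->
  1 / 128%:R <= \sum_A sample_parity f p A *
    [exists b in fourier_support f, (b != a) && (b - a \in span_set A)]%:R.
Proof.
set S := fourier_support f => fB S4 /andP[p0 p1] kp aS.
have p01 : 0 <= p <= 1 by rewrite ltW.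
have /fin_all_exists[v vP] : forall u, exists g, u \in S :\ a ->
    [/\ g != a, g != u, g \in S & g + (a + u) \in S].
  (* Outside [S :\ a] the value of [v] is a mere default. *)
  move=> u; have [|_] := boolP (u \in S :\ a); last by exists u.
  rewrite 2!inE => /andP[ua uS].
  have [|g gP] := fourier_support_folding fB aS uS; first by rewrite eq_sym.
  by exists g.
pose w u := v u + (a + u).
(* The pair determines [u], since [v u + w u = a + u]. *)
have vw_inj : {in S :\ a &, injective (fun u => (v u, w u))}.
  by move=> u u' _ _ /= [vE]; rewrite /w vE => /addrI/addrI.
have Dk : #|S :\ a|.+1 = #|S| by rewrite (cardsD1 a S) aS.
have [U [x [UD kU xvw deg]]] := low_indegree_choice p0 kp S4 Dk vw_inj.
have wP u : u \in U -> [/\ w u != a, w u != u & w u \in S].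
  move=> /(subsetP UD)/vP[va vu _ wS]; split => //.
    apply: contra_neq vu => wa.
    by rewrite -[LHS]addr0 -(addrrF2 (a + u)) addrA -/(w u) wa addrA addrrF2 add0r.
  apply: contra_neq va => wu.
  rewrite -[LHS]addr0 -(addrrF2 (a + u)) addrA -/(w u) wu.
  by rewrite addrCA addrrF2 addr0.
have xS u : u \in U -> x u \in S /\ x u != u.
  move=> uU; have [_ wu wS] := wP u uU.
  have [_ vu vS _] := vP u (subsetP UD u uU).
  by case: (xvw u) => ->.
have US : U \subset S by apply: subset_trans UD (subsetDl _ _).
apply: le_trans (edge_hitting_prob p01 kp US kU xS deg) _.
apply: ler_sum => A _; apply: (ler_wpM2l (subset_pmf_ge0 S A p01)).
rewrite ler_nat; case: exists_inP => // -[u uU].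
rewrite subUset !sub1set => /andP[uA xA]; rewrite lt0b.
have memA y : y \in A -> y \in span_set A by move=> yA; rewrite memv_span ?mem_enum.
have [wa wu wS] := wP u uU; have [va vu vS _] := vP u (subsetP UD u uU).
(* The candidate not chosen as [x u] is the one colliding with [a]: it differs from [a] by
   [u + x u], which lies in the span. *)
have [xv|xw] := xvw u; apply/exists_inP.
  exists (w u); rewrite // wa.
  have -> : w u - a = x u + u by rewrite /w xv -addrA [a + u]addrC addrK.
  by rewrite memvD ?memA.
exists (v u); rewrite // va.
have -> : v u - a = x u - u by rewrite xw /w addrA addrK opprF2.
by rewrite memvB ?memA.
Qed.

End Buckets.

(** * Averaging the savings over the support *)

Theorem theorem1 (R : realType) :
  exists (c : R) (k0 : nat),
    [/\ 0 <= c, c < 1 &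
      forall (n : nat) (f : 'rV['F_2]_n -> R),
        boolean_valued f ->
        (k0 <= sparsity f)%N ->
        let k : R := (sparsity f)%:R in
        let p : R := 1 / (2 * Num.sqrt k) in
        expectation (sample_parity f p)
          (fun A => (bucket_complexity f (span_set A))%:R) <= c * k].
Proof.
(* Each support element collides with probability at least 1/128 and then saves half a bucket; the
   threshold 4 is that of [low_indegree_choice]. *)
exists (1 - 1 / 256%:R), 4%N; split; [lra | lra | move=> n f fB k4; cbv zeta].
set k : R := (sparsity f)%:R; set p : R := 1 / (2 * Num.sqrt k).
have k4' : 4 <= k by rewrite ler_nat.
have k0 : 0 < k by lra.
have sqrtk : Num.sqrt k ^+ 2 = k by rewrite sqr_sqrtr // ltW.
have sqrtk0 : 0 < Num.sqrt k by rewrite sqrtr_gt0.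
have kp : 4 * k * p ^+ 2 = 1.
  rewrite /p expr_div_n expr1n exprMn sqrtk; field.
  by rewrite gt_eqF.
have p0 : 0 < p by rewrite divr_gt0 ?mulr_gt0.
have p01 : 0 < p <= 1 by rewrite p0 /=; nra.
have p01' : 0 <= p <= 1 by case/andP: p01 => /ltW-> ->.
rewrite /expectation.
pose S := fourier_support f.
pose hit A a : R := [exists b in S, (b != a) && (b - a \in span_set A)]%:R.
apply: le_trans (_ : \sum_A sample_parity f p A *
    (k - (\sum_(a in S) hit A a) / 2) <= _).
  apply: ler_sum => A _; apply: (ler_wpM2l (subset_pmf_ge0 S A p01')).
  exact: bucket_complexity_collisions.
(* Linearity of expectation; the constant [k] survives because the masses sum to 1. *)
have -> : \sum_A sample_parity f p A * (k - (\sum_(a in S) hit A a) / 2) =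
    k - (\sum_(a in S) \sum_A sample_parity f p A * hit A a) / 2.
  rewrite exchange_big /= mulr_suml -[in RHS](mul1r k).
  rewrite -(sum_subset_pmf S p) mulr_suml -sumrB; apply: eq_bigr => A _.
  by rewrite -mulr_sumr mulrBr mulrA.
have : \sum_(a in S) (1 / 128%:R) <=
    \sum_(a in S) \sum_A sample_parity f p A * hit A a.
  by apply: ler_sum => a aS; apply: collision_prob.
rewrite sumr_const -[_ *+ #|_|]mulr_natr -/(sparsity f) -/k; lra.
Qed.
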